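(* $$\frac{45\pi}{4} = \sum_{k=0}^{\infty}\left(\frac4{27}\right)^{k}\frac{(1)_k\left(\frac12\right)_k\left(\frac12\right)_k\left(\frac12\right)_k}{\left(\frac76\right)_k\left(\frac54\right)_k\left(\frac74\right)_k\left(\frac{11}{6}\right)_k}\,\left(184k^3+338k^2+193k+32\right).$$
   Context: For $k\in\mathbb{N}_0$, $(\alpha)_k=\alpha(\alpha+1)\cdots(\alpha+k-1)$ is the rising factorial (Pochhammer symbol), with $(\alpha)_0=1$. *)

(* Defs.v *)
From Stdlib Require Import Reals.
Open Scope R_scope.

(* [pochhammer a k] is the rising factorial (a)_k = a (a+1) ... (a+k-1). *)
Fixpoint pochhammer (a : R) (k : nat) : R :=
  match k with
  | O => 1
  | S j => pochhammer a j * (a + INR j)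
  end.

(* Main.v *)
Require Import Defs.
From Stdlib Require Import Reals.
From Stdlib Require Import Lra.
From Coquelicot Require Import Coquelicot.
Open Scope R_scope.

(** A WZ acceleration of Leibniz's series.  The well-poised summand
    [(-1)^j (a+2j) (b)_j (c)_j (d)_j / ((1+a-b)_j (1+a-c)_j (1+a-d)_j)],
    normalised by the Gamma products of the corresponding bilateral sum and
    taken at [a = 1+3n], [b = 1+2n], [c = 1/2+n], [d = 1/2], gives a function
    [F n j] with a rational certificate:
    [F (n+1) j - F n j = G n (j+1) - G n j].
    For [n = 0] it is [45 (-1)^j / (2j+1)], with sum [45 PI / 4], while
    [G n 0] is the [n]-th term of the series in question.  Summation over [j]
    shows that the sum of [F n j] over [j] is [45 PI / 4] minus the sum of the
    first [n] terms, and this remainder is O(2^-n). *)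

(** * Telescoping series and Leibniz's series *)

Lemma is_series_telescope (b : nat -> R) :
  is_lim_seq b 0 -> is_series (fun j => b (S j) - b j) (- b O).
Proof.
  intros Hb.
  assert (E : forall m, b (S m) - b O = sum_n (fun j => b (S j) - b j) m).
  { induction m as [|m IH].
    - now rewrite sum_O.
    - rewrite sum_Sn, <- IH. unfold plus; simpl. ring. }
  change (is_lim_seq (sum_n (fun j => b (S j) - b j)) (- b O)).
  apply (is_lim_seq_ext _ _ _ E).
  replace (- b O) with (0 - b O) by ring.
  apply is_lim_seq_minus'.
  - now apply (is_lim_seq_incr_1 b).
  - apply is_lim_seq_const.
Qed.

Lemma is_series_Leibniz : is_series (fun j => (-1) ^ j / (2 * INR j + 1)) (PI / 4).
Proof.
  rewrite <- Alt_PI_eq.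
  unfold Alt_PI. destruct exist_PI as [l Hl].
  replace (4 * l / 4) with l by field.
  apply is_series_Reals. intros eps Heps.
  destruct (Hl eps Heps) as [N HN]. exists N. intros n Hn.
  rewrite (sum_eq _ (tg_alt PI_tg)); [now apply HN|].
  intros i _. unfold tg_alt, PI_tg.
  rewrite plus_INR, mult_INR. simpl. reflexivity.
Qed.

(** * The WZ pair *)

Definition ratio_j (n j : R) :=
  (1 + 2 * n + j) * (1 / 2 + n + j) * (1 / 2 + j) /
  ((1 + n + j) * (5 / 2 + 2 * n + j) * (7 / 2 + 3 * n + j)).

Definition ratio_n (n j : R) :=
  (1 + 2 * n + j) * (2 + 2 * n + j) * (1 / 2 + n + j) *
  (n + 1 / 2) * (2 * n + 1) * (2 * n + 2) /
  ((1 + n + j) * (5 / 2 + 2 * n + j) * (7 / 2 + 2 * n + j) *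
   (7 / 2 + 3 * n + j) * (9 / 2 + 3 * n + j) * (11 / 2 + 3 * n + j)).

Definition coeff (k : nat) : R :=
  (4 / 27) ^ k *
  ((pochhammer 1 k * pochhammer (1 / 2) k *
    pochhammer (1 / 2) k * pochhammer (1 / 2) k) /
   (pochhammer (7 / 6) k * pochhammer (5 / 4) k *
    pochhammer (7 / 4) k * pochhammer (11 / 6) k)).

(* Up to a constant factor,
   [(2n)! (1/2)_n Gamma(1+2n+j) Gamma(1/2+n+j) Gamma(1/2+j)
    / (Gamma(1+n+j) Gamma(5/2+2n+j) Gamma(7/2+3n+j))]. *)
Fixpoint kernel (n j : nat) : R :=
  match j with
  | O => coeff n * 8 / (2 * INR n + 1)
  | S i => kernel n i * ratio_j (INR n) (INR i)
  end.

Lemma kernel_O (n : nat) : kernel n 0 = coeff n * 8 / (2 * INR n + 1).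
Proof. reflexivity. Qed.

Lemma kernel_Sj (n j : nat) : kernel n (S j) = kernel n j * ratio_j (INR n) (INR j).
Proof. reflexivity. Qed.

(** The well-poised factor a + 2j, times the factors that lower Gamma(5/2+2n+j) and Gamma(7/2+3n+j)
    in [kernel] to Gamma(3/2+2n+j) and Gamma(3/2+3n+j). *)
Definition wz_factor (n j : R) :=
  (1 + 3 * n + 2 * j) * (3 / 2 + 2 * n + j) *
  (3 / 2 + 3 * n + j) * (5 / 2 + 3 * n + j).

(* Found by solving Gosper's equation for a polynomial of degree 4 in [j]. *)
Definition wz_cert (n j : R) :=
  (184 * n ^ 3 + 338 * n ^ 2 + 193 * n + 32) * (2 * n + 1) / 8 +
  (113 / 8 + 311 / 4 * n + 273 / 2 * n ^ 2 + 77 * n ^ 3) * j +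
  (61 / 4 + 107 / 2 * n + 45 * n ^ 2) * j ^ 2 +
  (13 / 2 + 11 * n) * j ^ 3 + j ^ 4.

(* [F n j = (-1)^j absF n j] and [G n j = (-1)^j absG n j]. *)
Definition absF (n j : nat) := kernel n j * wz_factor (INR n) (INR j).
Definition absG (n j : nat) := kernel n j * wz_cert (INR n) (INR j).

(** * Shift quotients and the WZ equation *)

Lemma pochhammer_pos (a : R) (k : nat) : 0 < a -> 0 < pochhammer a k.
Proof.
  intros Ha. induction k as [|k IH]; simpl; [lra|].
  apply Rmult_lt_0_compat; [exact IH|]. pose proof (pos_INR k). lra.
Qed.

Lemma coeff_pos (k : nat) : 0 < coeff k.
Proof.
  unfold coeff. apply Rmult_lt_0_compat; [apply pow_lt; lra|].
  apply Rdiv_lt_0_compat; repeat apply Rmult_lt_0_compat; apply pochhammer_pos; lra.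
Qed.

Lemma coeff_S (k : nat) :
  coeff (S k) = coeff k * (4 / 27 * ((1 + INR k) * (1 / 2 + INR k) ^ 3 /
    ((7 / 6 + INR k) * (5 / 4 + INR k) * (7 / 4 + INR k) * (11 / 6 + INR k)))).
Proof.
  unfold coeff; simpl pochhammer; simpl pow.
  pose proof (pos_INR k).
  pose proof (pochhammer_pos (7 / 6) k). pose proof (pochhammer_pos (5 / 4) k).
  pose proof (pochhammer_pos (7 / 4) k). pose proof (pochhammer_pos (11 / 6) k).
  field. repeat split; lra.
Qed.

Lemma ratio_j_pos (n j : R) : 0 <= n -> 0 <= j -> 0 < ratio_j n j.
Proof.
  intros. apply Rdiv_lt_0_compat; repeat apply Rmult_lt_0_compat; lra.
Qed.

Lemma kernel_pos (n j : nat) : 0 < kernel n j.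
Proof.
  pose proof (pos_INR n).
  induction j as [|j IH]; [rewrite kernel_O|rewrite kernel_Sj].
  - pose proof (coeff_pos n). apply Rdiv_lt_0_compat; lra.
  - apply Rmult_lt_0_compat; [exact IH|]. apply ratio_j_pos; apply pos_INR.
Qed.

(** Induction on j: the base case is [coeff_S], the step is the compatibility of the two shifts,
    ratio_n n (j+1) * ratio_j n j = ratio_j (n+1) j * ratio_n n j. *)
Lemma kernel_Sn (n j : nat) : kernel (S n) j = kernel n j * ratio_n (INR n) (INR j).
Proof.
  pose proof (pos_INR n) as Hn.
  induction j as [|j IH].
  - rewrite !kernel_O, coeff_S, S_INR. simpl INR. unfold ratio_n. field. repeat split; lra.
  - rewrite !kernel_Sj, IH, !S_INR. pose proof (pos_INR j) as Hj.
    unfold ratio_n, ratio_j. field. repeat split; lra.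
Qed.

(** Divided by [kernel n j], this is an identity of rational functions in n and j. The sign
    (-1)^(j+1) of G n (j+1) turns the difference of the G into a sum. *)
Lemma wz_equation (n j : nat) :
  absF (S n) j - absF n j = - (absG n (S j) + absG n j).
Proof.
  unfold absF, absG. rewrite kernel_Sn, kernel_Sj. rewrite !S_INR.
  pose proof (pos_INR n) as Hn. pose proof (pos_INR j) as Hj.
  unfold ratio_n, ratio_j, wz_factor, wz_cert. field. repeat split; lra.
Qed.

(** At n = 0 the factors 1 + j of [ratio_j] cancel and the remaining product telescopes. *)
Lemma kernel_0 (j : nat) :
  kernel 0 j = 45 / ((2 * INR j + 1) ^ 2 * (3 / 2 + INR j) ^ 2 * (5 / 2 + INR j)).
Proof.
  induction j as [|j IH].
  - rewrite kernel_O. unfold coeff. simpl. field.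
  - rewrite kernel_Sj, IH, S_INR. pose proof (pos_INR j).
    unfold ratio_j. simpl INR. field. repeat split; lra.
Qed.

Lemma absF_0 (j : nat) : absF 0 j = 45 / (2 * INR j + 1).
Proof.
  unfold absF. rewrite kernel_0. pose proof (pos_INR j).
  unfold wz_factor. simpl INR. field. repeat split; lra.
Qed.

(** * Positivity and size of F and G *)

Lemma wz_factor_pos (n j : R) : 0 <= n -> 0 <= j -> 0 < wz_factor n j.
Proof.
  intros. repeat apply Rmult_lt_0_compat; lra.
Qed.

Lemma absF_pos (n j : nat) : 0 < absF n j.
Proof.
  apply Rmult_lt_0_compat; [apply kernel_pos|].
  apply wz_factor_pos; apply pos_INR.
Qed.

(** For expanded polynomials with nonnegative coefficients in nonnegative variables, to which the
    estimates below reduce. *)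
Ltac nonneg :=
  repeat first [ assumption | apply Rplus_le_le_0_compat | apply Rmult_le_pos
               | apply Rdiv_le_0_compat | apply pow_le ]; lra.

Lemma absF_Sn_le (n j : nat) : absF (S n) j <= absF n j / 2.
Proof.
  unfold absF. rewrite kernel_Sn, S_INR.
  pose proof (kernel_pos n j) as HK.
  pose proof (pos_INR n) as Hn. pose proof (pos_INR j) as Hj.
  set (x := INR n) in *. set (y := INR j) in *.
  enough (ratio_n x y * wz_factor (x + 1) y <= wz_factor x y / 2) by nra.
  replace (ratio_n x y * wz_factor (x + 1) y) with
    ((1 + 2 * x + y) * (2 + 2 * x + y) * (1 / 2 + x + y) *
     (x + 1 / 2) * (2 * x + 1) * (2 * x + 2) * (4 + 3 * x + 2 * y) /
     ((1 + x + y) * (5 / 2 + 2 * x + y) * (7 / 2 + 3 * x + y)))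
    by (unfold ratio_n, wz_factor; field; repeat split; lra).
  apply Rle_div_l; [repeat apply Rmult_lt_0_compat; lra|].
  apply Rminus_le_0. unfold wz_factor. field_simplify. nonneg.
Qed.

(** [absF 0 j] decays only like 1/j, so the summable bound starts at n = 1. The majorant telescopes,
    with sum 45 over j. *)
Lemma absF_1_le (j : nat) :
  absF 1 j <= 45 * (1 / (INR j + 1) - 1 / (INR j + 2)).
Proof.
  unfold absF. rewrite kernel_Sn, kernel_0.
  pose proof (pos_INR j) as Hj. simpl INR. set (y := INR j) in *.
  apply Rminus_le_0.
  unfold ratio_n, wz_factor. field_simplify; [|repeat split; lra].
  apply Rdiv_le_0_compat.
  - nonneg.
  - apply Rplus_le_lt_0_compat; [nonneg|lra].
Qed.

Lemma absF_le_geom (n j : nat) :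
  absF (S n) j <= 45 * (1 / 2) ^ n * (1 / (INR j + 1) - 1 / (INR j + 2)).
Proof.
  induction n as [|n IH].
  - pose proof (absF_1_le j). simpl pow. lra.
  - pose proof (absF_Sn_le (S n) j). simpl pow. lra.
Qed.

Lemma absG_bounds (n j : nat) : 0 <= absG n j <= absF n j.
Proof.
  unfold absG, absF. pose proof (kernel_pos n j) as HK.
  pose proof (pos_INR n) as Hn. pose proof (pos_INR j) as Hj.
  set (x := INR n) in *. set (y := INR j) in *.
  split.
  - apply Rmult_le_pos; [lra|]. unfold wz_cert. nonneg.
  - apply Rmult_le_compat_l; [lra|]. apply Rminus_le_0.
    unfold wz_factor, wz_cert. field_simplify. nonneg.
Qed.

(** The factor (2n+1)/8 in the constant term of [wz_cert] cancels the 8/(2n+1) in [kernel n 0]. *)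
Lemma absG_0 (k : nat) :
  absG k 0 = coeff k * (184 * INR k ^ 3 + 338 * INR k ^ 2 + 193 * INR k + 32).
Proof.
  unfold absG. rewrite kernel_O. unfold wz_cert.
  pose proof (pos_INR k). simpl (INR 0). field. lra.
Qed.

(** Not summable in j, but enough for G n j to vanish as j grows, for every n. *)
Lemma absF_le_harmonic (n j : nat) : absF n j <= 45 / (2 * INR j + 1).
Proof.
  induction n as [|n IH].
  - rewrite absF_0. lra.
  - pose proof (absF_Sn_le n j). pose proof (absF_pos n j). lra.
Qed.

(** * Summation over j and the limit in n *)

Lemma is_lim_seq_signed_absG (n : nat) :
  is_lim_seq (fun j => (-1) ^ j * absG n j) 0.
Proof.
  apply is_lim_seq_abs_0.
  apply (is_lim_seq_le_le (fun _ => 0) _ (fun j => 45 * / (2 * INR j + 1))).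
  - intros j. rewrite Rabs_mult, pow_1_abs, Rmult_1_l.
    pose proof (absG_bounds n j). pose proof (absF_le_harmonic n j).
    rewrite Rabs_pos_eq by lra. unfold Rdiv in *. lra.
  - apply is_lim_seq_const.
  - replace (Finite 0) with (Rbar_mult 45 0) by (simpl; f_equal; ring).
    apply is_lim_seq_scal_l.
    replace (Finite 0) with (Rbar_inv p_infty) by reflexivity.
    apply is_lim_seq_inv; [|discriminate].
    apply (is_lim_seq_le_p_loc INR); [|apply is_lim_seq_INR].
    exists O. intros j _. pose proof (pos_INR j). lra.
Qed.

Lemma is_series_F (n : nat) :
  is_series (fun j => (-1) ^ j * absF (S n) j)
    (45 * PI / 4 - sum_n (fun i => absG i 0) n).
Proof.
  (* The WZ equation summed over j: the G side telescopes to - G m 0. *)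
  assert (Hstep : forall m l, is_series (fun j => (-1) ^ j * absF m j) l ->
            is_series (fun j => (-1) ^ j * absF (S m) j) (l - absG m 0)).
  { intros m l Hl.
    pose proof (is_series_telescope _ (is_lim_seq_signed_absG m)) as HG.
    pose proof (is_series_plus _ _ _ _ Hl HG) as H.
    replace (l - absG m 0) with (plus l (- ((-1) ^ 0 * absG m 0)))
      by (unfold plus; simpl; ring).
    revert H. apply is_series_ext. intros j.
    replace (absF (S m) j) with (absF m j - (absG m (S j) + absG m j))
      by (pose proof (wz_equation m j); lra).
    unfold plus; simpl. ring. }
  induction n as [|n IH].
  - rewrite sum_O. apply Hstep.
    replace (45 * PI / 4) with (scal 45 (PI / 4))
      by (unfold scal; simpl; unfold mult; simpl; field).
    apply (is_series_ext (fun j => scal 45 ((-1) ^ j / (2 * INR j + 1)))).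
    + intros j. rewrite absF_0. unfold scal; simpl; unfold mult; simpl.
      pose proof (pos_INR j). field. lra.
    + apply (is_series_scal_l (K := R_AbsRing) (V := R_NormedModule)).
      exact is_series_Leibniz.
  - rewrite sum_Sn. apply Hstep in IH. unfold plus; simpl.
    now rewrite Rminus_plus_distr.
Qed.

Lemma partial_sum_error (n : nat) :
  Rabs (sum_n (fun k => absG k 0) n - 45 * PI / 4) <= 45 * (1 / 2) ^ n.
Proof.
  rewrite Rabs_minus_sym.
  pose proof (is_series_F n) as H.
  apply (is_lim_seq_abs (sum_n (fun j => (-1) ^ j * absF (S n) j))
           (45 * PI / 4 - sum_n (fun k => absG k 0) n)) in H.
  refine (is_lim_seq_le _ (fun _ => 45 * (1 / 2) ^ n) _ _ _ H (is_lim_seq_const _)).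
  pose proof (pow_lt (1 / 2) n ltac:(lra)) as Hp.
  intros m.
  (* Keeping the tail 1 / (m + 2) of the telescoped majorant makes the induction on m go through. *)
  enough (Rabs (sum_n (fun j => (-1) ^ j * absF (S n) j) m)
          <= 45 * (1 / 2) ^ n * (1 - 1 / (INR m + 2))).
  { pose proof (pos_INR m).
    assert (0 < 1 / (INR m + 2)) by (apply Rdiv_lt_0_compat; lra). nra. }
  assert (Habs : forall j, Rabs ((-1) ^ j * absF (S n) j)
            <= 45 * (1 / 2) ^ n * (1 / (INR j + 1) - 1 / (INR j + 2))).
  { intros j. rewrite Rabs_mult, pow_1_abs, Rmult_1_l.
    pose proof (absF_pos (S n) j). rewrite Rabs_pos_eq by lra.
    apply absF_le_geom. }
  induction m as [|m IH].
  - rewrite sum_O. specialize (Habs O). simpl INR in *. lra.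
  - rewrite sum_Sn. specialize (Habs (S m)).
    eapply Rle_trans; [apply Rabs_triang|]. rewrite S_INR in *.
    replace (INR m + 1 + 1) with (INR m + 2) in Habs by ring. lra.
Qed.

Theorem mainTheorem17 :
  is_series
    (fun k : nat =>
       (4 / 27) ^ k *
       ((pochhammer 1 k * pochhammer (1 / 2) k *
         pochhammer (1 / 2) k * pochhammer (1 / 2) k) /
        (pochhammer (7 / 6) k * pochhammer (5 / 4) k *
         pochhammer (7 / 4) k * pochhammer (11 / 6) k)) *
       (184 * INR k ^ 3 + 338 * INR k ^ 2 + 193 * INR k + 32))
    (45 * PI / 4).
Proof.
  apply (is_series_ext (fun k => absG k 0)).
  { exact absG_0. }
  change (is_lim_seq (sum_n (fun k => absG k 0)) (45 * PI / 4)).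
  apply (is_lim_seq_ext (fun n => sum_n (fun k => absG k 0) n - 45 * PI / 4 + 45 * PI / 4));
    [intros n; ring|].
  replace (Finite (45 * PI / 4)) with (Finite (0 + 45 * PI / 4)) by (f_equal; ring).
  apply is_lim_seq_plus'; [|apply is_lim_seq_const].
  apply is_lim_seq_abs_0.
  apply (is_lim_seq_le_le (fun _ => 0) _ (fun n => 45 * (1 / 2) ^ n)).
  - intros n. split; [apply Rabs_pos|apply partial_sum_error].
  - apply is_lim_seq_const.
  - replace (Finite 0) with (Rbar_mult 45 0) by (simpl; f_equal; ring).
    apply is_lim_seq_scal_l, is_lim_seq_geom. rewrite Rabs_pos_eq; lra.
Qed.
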